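(* Let $\mathfrak g$ be a semisimple Lie algebra over $\mathbb C$, let $M$ be a complex affine variety with algebra of functions $A$, let $\lambda$ be a dominant weight of $\mathfrak g$ and let $\{\mathcal Z\}_\lambda$ be a $\lambda$-multiset of points of $M$. Then the local Weyl module $W_M(\{\mathcal Z\}_\lambda)$ is finite-dimensional.
   Context: All vector spaces and algebras are over $\mathbb C$. Let $r$ be the rank of $\mathfrak g$, $\mathfrak h\subset\mathfrak g$ a Cartan subalgebra, $\mathfrak n_+$ the nilpotent radical of the positive Borel subalgebra, $e_i,h_i,f_i$ ($i=1,\dots,r$) the Chevalley generators, $P\subset\mathfrak h^*$ the weight lattice. A $\mathfrak g$-module $V$ is integrable if there is a finite subset $D\subset P$ with $V=\bigoplus_{\mu\in D}V^\mu$, where each $h\in\mathfrak h$ acts on $V^\mu$ by the scalar $\mu(h)$ (the spaces $V^\mu$ may be infinite-dimensional). A $\mathfrak g\otimes A$-module is $\mathfrak g\otimes 1$-integrable if it is integrable over $\mathfrak g\cong\mathfrak g\otimes 1$. The bracket on $\mathfrak g\otimes A$ is $[x\otimes P,y\otimes Q]=[x,y]\otimes PQ$. $M$ may be singular. A weight $\lambda$ is dominant if all $\lambda_i=\lambda(h_i)$ are non-negative integers. A $\lambda$-multiset $\{\mathcal Z\}_\lambda$ is a family of points $\mathcal Z^{(i)}_j\in M$ (not necessarily distinct), $i=1,\dots,r$, $j=1,\dots,\lambda_i$. The local Weyl module $W_M(\{\mathcal Z\}_\lambda)$ is the maximal $\mathfrak g\otimes 1$-integrable $\mathfrak g\otimes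 A$-module generated by a vector $v$ such that for all $P\in A$ and $i=1,\dots,r$ $$(\mathfrak n_+\otimes P)\,v=0,\qquad (h_i\otimes P)\,v=\sum_{j=1}^{\lambda_i}P(\mathcal Z^{(i)}_j)\,v .$$ ''Maximal'' means that any other such module is a quotient of it (generator mapping to generator). *)

(* Defs.v *)
From HB Require Import structures.
From mathcomp Require Import all_boot all_order all_algebra.
From mathcomp Require Import boolp classical_sets functions reals.
From mathcomp Require Import complex mpoly.

Set Implicit Arguments.
Unset Strict Implicit.
Unset Printing Implicit Defensive.

Import Order.TTheory GRing.Theory Num.Theory.
Local Open Scope ring_scope.

HB.mixin Record isLie (K : pzRingType) L of GRing.Lmodule K L := {
  lie : L -> L -> L;
  lie_linearl : forall y, linear (fun x => lie x y);
  lie_linearr : forall x, linear (lie x);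
  liexx : forall x, lie x x = 0;
  lie_jacobi : forall x y z,
    lie x (lie y z) + lie y (lie z x) + lie z (lie x y) = 0 }.

#[short(type="lieAlgType")]
HB.structure Definition LieAlgebra (K : pzRingType) :=
  {L of isLie K L & GRing.Lmodule K L}.

#[short(type="finLieAlgType")]
HB.structure Definition FinLieAlgebra (K : nzRingType) :=
  {L of isLie K L & Vector K L}.

Notation "[ 'lie' x , y ]" := (lie x y)
  (at level 0, x, y at level 99, format "[ 'lie'  x ,  y ]") : ring_scope.

Section SemisimpleLieAlgebras.
Variables (K : fieldType) (L : finLieAlgType K).
Implicit Types (U V B H I N : {vspace L}).

Definition lie_prod U V : {vspace L} :=
  <<[seq [lie x, y] | x <- vbasis U, y <- vbasis V]>>%VS.

Definition derived_series U n : {vspace L} :=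
  iter n (fun W => lie_prod W W) U.

Definition lower_central_series U n : {vspace L} :=
  iter n (fun W => lie_prod U W) U.

Definition lie_solvable U := exists n, derived_series U n = 0%VS.

Definition lie_nilpotent U := exists n, lower_central_series U n = 0%VS.

Definition lie_subalgebra U :=
  forall x y, x \in U -> y \in U -> [lie x, y] \in U.

Definition lie_ideal B I :=
  (I <= B)%VS /\ forall x y, x \in B -> y \in I -> [lie x, y] \in I.

Definition semisimple :=
  forall I, lie_ideal fullv I -> lie_solvable I -> I = 0%VS.

Definition cartan_subalgebra H :=
  [/\ lie_subalgebra H, lie_nilpotent H &
      forall x, (forall y, y \in H -> [lie x, y] \in H) -> x \in H].

(* The nilpotent radical is the largest nilpotent ideal. *)
Definition is_nilradical B N :=
  [/\ lie_ideal B N, lie_nilpotent N &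
      forall N', lie_ideal B N' -> lie_nilpotent N' -> (N' <= N)%VS].

End SemisimpleLieAlgebras.

Definition weight (K : fieldType) (L : finLieAlgType K) (H : {vspace L}) :=
  'Hom(subvs_of H, K^o).

HB.instance Definition _ (K : fieldType) (L : finLieAlgType K)
  (H : {vspace L}) := Vector.copy (weight H) 'Hom(subvs_of H, K^o).

Section RootsAndGenerators.
Variables (K : fieldType) (L : finLieAlgType K) (H : {vspace L}).

Definition root_vector (beta : weight H) (x : L) :=
  forall t : subvs_of H, [lie vsval t, x] = beta t *: x.

Definition is_root (beta : weight H) :=
  beta != 0 /\ exists2 x, x != 0 & root_vector beta x.

(* Simple roots; their number is the rank, i.e. the dimension of H. *)
Variable alpha : 'I_(\dim H) -> weight H.

Definition nonneg_comb (beta : weight H) :=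
  exists n : 'I_(\dim H) -> nat, beta = \sum_i alpha i *+ n i.

Definition simple_roots :=
  [/\ forall i, is_root (alpha i), free (codom alpha) &
      forall beta, is_root beta -> nonneg_comb beta \/ nonneg_comb (- beta)].

Definition positive_root (beta : weight H) := is_root beta /\ nonneg_comb beta.

(* The positive Borel subalgebra, as the smallest subspace containing H and
   the root spaces of all positive roots. *)
Definition is_positive_borel (B : {vspace L}) :=
  let contains (U : {vspace L}) := (H <= U)%VS /\
    forall beta x, positive_root beta -> root_vector beta x -> x \in U in
  contains B /\ forall U : {vspace L}, contains U -> (B <= U)%VS.

Definition chevalley_generators (e : 'I_(\dim H) -> L)
    (h : 'I_(\dim H) -> subvs_of H) (f : 'I_(\dim H) -> L) :=
  [/\ forall i, root_vector (alpha i) (e i) /\ root_vector (- alpha i) (f i),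
      forall i j, [lie e i, f j] = if i == j then vsval (h i) else 0,
      forall i, alpha i (h i) = 2%:R &
      forall U : {vspace L}, lie_subalgebra U ->
        (forall i, e i \in U /\ f i \in U) -> U = fullv].

End RootsAndGenerators.

Section Weights.
Variables (K : fieldType) (L : finLieAlgType K) (H : {vspace L}).
Variable h : 'I_(\dim H) -> subvs_of H.

(* The h i are the simple coroots, a basis of H. *)
Definition in_weight_lattice (mu : weight H) :=
  forall i, exists z : int, mu (h i) = z%:~R.

Definition dominant (lam : weight H) :=
  forall i, exists n : nat, lam (h i) = n%:R.

(* Z i lists the points attached to the i-th simple coroot; there are lam (h i)
   of them, with repetitions allowed. *)
Definition is_multiset (M : Type) (lam : weight H)
    (Z : 'I_(\dim H) -> seq M) :=
  forall i, (size (Z i))%:R = lam (h i).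

End Weights.

Record lieModule (K : fieldType) (L : lieAlgType K) := LieModule {
  lmod_of :> lmodType K;
  lact : L -> lmod_of -> lmod_of;
  lact_linearl : forall w, linear (lact^~ w);
  lact_linearr : forall x, linear (lact x);
  lact_lie : forall x y w,
    lact [lie x, y] w = lact x (lact y w) - lact y (lact x w) }.

Section Modules.
Variables (K : fieldType) (L : lieAlgType K).

(* v lies in no proper submodule of V. *)
Definition generated_by (V : lieModule L) (v : V) :=
  forall S : V -> Prop,
    (forall a w1 w2, S w1 -> S w2 -> S (a *: w1 + w2)) ->
    (forall x w, S w -> S (lact x w)) -> S v -> forall w, S w.

Definition module_morphism (V W : lieModule L) (phi : V -> W) :=
  linear phi /\ forall x w, phi (lact x w) = lact x (phi w).

End Modules.

Definition finite_dimensional (K : fieldType) (V : lmodType K) :=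
  exists n (b : 'I_n -> V), forall w, exists c : 'I_n -> K,
    w = \sum_i c i *: b i.

Section Integrable.
Variables (K : fieldType) (L : finLieAlgType K) (H : {vspace L}).
Variable h : 'I_(\dim H) -> subvs_of H.

Definition weight_vector (V : lieModule L) (mu : weight H) (w : V) :=
  forall t : subvs_of H, lact (vsval t) w = mu t *: w.

(* V is the internal direct sum of its weight spaces for the weights in D. *)
Definition integrable (V : lieModule L) :=
  exists D : seq (weight H),
    [/\ uniq D,
        forall mu, mu \in D -> in_weight_lattice h mu,
        (forall w : V, exists c : weight H -> V,
          (forall mu, mu \in D -> weight_vector mu (c mu)) /\
          w = \sum_(mu <- D) c mu) &
        (forall c : weight H -> V,
          (forall mu, mu \in D -> weight_vector mu (c mu)) ->
          \sum_(mu <- D) c mu = 0 -> forall mu, mu \in D -> c mu = 0)].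

End Integrable.

(* Zariski closed subsets of affine space; no irreducibility is assumed. *)
Record affineVariety (K : fieldType) := AffineVariety {
  ambient_dim : nat;
  zero_locus : set 'rV[K]_ambient_dim;
  zero_locusP : exists S : set {mpoly K[ambient_dim]},
    zero_locus = [set x | forall p, S p -> p.@[x ord0] = 0]%classic }.

Definition point (K : fieldType) (M : affineVariety K) : Type :=
  {x : 'rV[K]_(ambient_dim M) | zero_locus x}.

Section CoordinateRing.
Variables (K : fieldType) (M : affineVariety K).

Definition polyfun (p : {mpoly K[ambient_dim M]}) : point M -> K^o :=
  fun z => p.@[sval z ord0].

Definition regular : pred (point M -> K^o) :=
  fun F => `[< exists p, F = polyfun p >].

Lemma regular_subring : subring_closed regular.
Proof.
split.
- by apply/asboolP; exists 1; apply/funext => z; rewrite /polyfun meval1.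
- move=> F G /asboolP[p ->] /asboolP[q ->]; apply/asboolP; exists (p - q).
  by apply/funext => z; rewrite /polyfun mevalB.
- move=> F G /asboolP[p ->] /asboolP[q ->]; apply/asboolP; exists (p * q).
  by apply/funext => z; rewrite /polyfun mevalM.
Qed.

Lemma regular_submod : submod_closed regular.
Proof.
split.
- by apply/asboolP; exists 0; apply/funext => z; rewrite /polyfun meval0.
- move=> a F G /asboolP[p ->] /asboolP[q ->]; apply/asboolP.
  by exists (a *: p + q); apply/funext => z; rewrite /polyfun mevalD mevalZ.
Qed.

HB.instance Definition _ :=
  GRing.isSubringClosed.Build _ regular regular_subring.
HB.instance Definition _ :=
  GRing.isSubmodClosed.Build _ _ regular regular_submod.

(* The zero locus may be empty, in which case this is the zero ring; hence only
   the possibly trivial ring structures are declared. *)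
Record coordRing := CoordRing {
  coord_fun :> point M -> K^o;
  _ : coord_fun \in regular }.

HB.instance Definition _ := [isSub for coord_fun].
HB.instance Definition _ := [Choice of coordRing by <:].
HB.instance Definition _ := [SubChoice_isSubZmodule of coordRing by <:].
HB.instance Definition _ :=
  [SubZmodule_isSubLmodule of coordRing by <:].
HB.instance Definition _ :=
  GRing.SubZmodule_isSubPzRing.Build _ _ coordRing (subringClosedP _).
HB.instance Definition _ :=
  GRing.SubPzRing_isSubComPzRing.Build _ _ coordRing.

End CoordinateRing.

Lemma coordZAl (K : fieldType) (M : affineVariety K) (a : K)
  (P Q : coordRing M) : a *: (P * Q) = (a *: P) * Q.
Proof. by apply/val_inj/funext => z; exact: mulrA. Qed.

Section LinearFunctions.
Variables (K : nzRingType) (U V : lmodType K) (F : U -> V).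
Hypothesis linF : linear F.
Let F' : {linear U -> V} :=
  HB.pack F (GRing.isLinear.Build K U V *:%R F linF).

Lemma linear_fun0 : F 0 = 0. Proof. exact: (linear0 F'). Qed.
Lemma linear_funN u : F (- u) = - F u. Proof. exact: (linearN F'). Qed.
Lemma linear_funD u v : F (u + v) = F u + F v. Proof. exact: (linearD F'). Qed.
Lemma linear_funZ a u : F (a *: u) = a *: F u. Proof. exact: (linearZ_LR F'). Qed.
Lemma linear_fun_sum I (r : seq I) G :
  F (\sum_(i <- r) G i) = \sum_(i <- r) F (G i).
Proof. exact: (linear_sum F'). Qed.
End LinearFunctions.

Section Currents.
Variables (K : numFieldType) (L : finLieAlgType K) (M : affineVariety K).
Local Notation A := (coordRing M).
Local Notation d := (\dim {:L}).
Local Notation b := (vbasis {:L}).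

(* L (x) A in coordinates: u stands for the sum of the b_i (x) u_i, where b is the
   chosen basis of L. *)
Definition current := {ffun 'I_d -> A}.

HB.instance Definition _ := GRing.Lmodule.copy current {ffun 'I_d -> A}.

Definition tens (x : L) (P : A) : current := [ffun i => coord b i x *: P].

Definition current_lie (u v : current) : current :=
  \sum_(i < d) \sum_(j < d) tens [lie b`_i, b`_j] (u i * v j).

Lemma tens_linearl P : linear (tens^~ P).
Proof.
move=> a x y; apply/ffunP => i; rewrite !ffunE linearP /= scalerDl -scalerA //.
Qed.

Lemma tens_linearr x : linear (tens x).
Proof.
move=> a P Q; apply/ffunP => i; rewrite !ffunE scalerDr !scalerA.
by rewrite (mulrC a).
Qed.

Lemma tensDr x P Q : tens x (P + Q) = tens x P + tens x Q.
Proof. exact: (linear_funD (tens_linearr x)). Qed.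

Lemma tensZr x a P : tens x (a *: P) = a *: tens x P.
Proof. exact: (linear_funZ (tens_linearr x)). Qed.

Lemma tens_suml (I : finType) (F : I -> L) P :
  tens (\sum_i F i) P = \sum_i tens (F i) P.
Proof. exact: (linear_fun_sum (tens_linearl P)). Qed.

Lemma tensZl x a P : tens (a *: x) P = a *: tens x P.
Proof. exact: (linear_funZ (tens_linearl P)). Qed.

Lemma tens_coord (u : current) : u = \sum_(i < d) tens b`_i (u i).
Proof.
apply/ffunP => i; rewrite sum_ffunE (bigD1 i) //= ffunE.
have fb : free b by exact: basis_free (vbasisP _).
rewrite coord_free // eqxx scale1r big1 ?addr0 // => j ji.
by rewrite ffunE coord_free // (negPf ji) scale0r.
Qed.

Fact current_lie_linearl v : linear (fun u => current_lie u v).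
Proof.
move=> a u w; rewrite /current_lie scaler_sumr -big_split; apply: eq_bigr => i _.
rewrite scaler_sumr -big_split; apply: eq_bigr => j _ /=.
by rewrite !ffunE mulrDl tensDr -coordZAl tensZr.
Qed.

Fact current_lie_linearr u : linear (current_lie u).
Proof.
move=> a v w; rewrite /current_lie scaler_sumr -big_split; apply: eq_bigr => i _.
rewrite scaler_sumr -big_split; apply: eq_bigr => j _ /=.
by rewrite !ffunE mulrDr tensDr mulrC -coordZAl tensZr [v j * _]mulrC.
Qed.

Lemma current_lie_tens x y P Q :
  current_lie (tens x P) (tens y Q) = tens [lie x, y] (P * Q).
Proof.
rewrite [x in RHS](coord_vbasis (memvf x)) [y in RHS](coord_vbasis (memvf y)).
rewrite (linear_fun_sum (lie_linearl _)) tens_suml.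
apply: eq_bigr => i _; rewrite (linear_fun_sum (lie_linearr _)) tens_suml.
apply: eq_bigr => j _; rewrite !ffunE.
rewrite (linear_funZ (lie_linearr _)) /= (linear_funZ (lie_linearl _)) /= !tensZl.
rewrite -coordZAl [P * _]mulrC -coordZAl !tensZr [Q * P]mulrC !scalerA.
by congr (_ *: _); exact: mulrC.
Qed.

Lemma lie_anti (x y : L) : [lie x, y] = - [lie y, x].
Proof.
apply/eqP; rewrite -addr_eq0; apply/eqP.
have := liexx (x + y); rewrite (linear_funD (lie_linearr _)) /=.
by rewrite !(linear_funD (lie_linearl _)) /= !liexx add0r addr0 addrC.
Qed.

Fact current_liexx u : current_lie u u = 0.
Proof.
have E : current_lie u u = - current_lie u u.
  rewrite {1}/current_lie exchange_big /= /current_lie -sumrN.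
  apply: eq_bigr => i _; rewrite -sumrN; apply: eq_bigr => j _.
  by rewrite lie_anti (linear_funN (tens_linearl _)) /= mulrC.
have : 2%:R *: current_lie u u = 0.
  by rewrite scaler_nat mulr2n {1}E addNr.
by move/eqP; rewrite scaler_eq0 pnatr_eq0 /= => /eqP.
Qed.

Fact current_lie_jacobi u v w :
  current_lie u (current_lie v w) + current_lie v (current_lie w u)
    + current_lie w (current_lie u v) = 0.
Proof.
have suml I (r : seq I) (F : I -> current) y :
  current_lie (\sum_(i <- r) F i) y = \sum_(i <- r) current_lie (F i) y.
  exact: (linear_fun_sum (current_lie_linearl y)).
have sumr I (r : seq I) (F : I -> current) y :
  current_lie y (\sum_(i <- r) F i) = \sum_(i <- r) current_lie y (F i).
  exact: (linear_fun_sum (current_lie_linearr y)).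
have E3 (u' v' w' : current) :
  current_lie u' (current_lie v' w') =
  \sum_(i < d) \sum_(j < d) \sum_(k < d)
    tens [lie b`_i, [lie b`_j, b`_k]] (u' i * (v' j * w' k)).
  rewrite {1}(tens_coord u') suml; apply: eq_bigr => i _.
  rewrite [current_lie v' w']/current_lie sumr; apply: eq_bigr => j _.
  by rewrite sumr; apply: eq_bigr => k _; rewrite current_lie_tens.
rewrite !E3.
have -> : \sum_(i < d) \sum_(j < d) \sum_(k < d)
    tens [lie b`_i, [lie b`_j, b`_k]] (v i * (w j * u k)) =
  \sum_(i < d) \sum_(j < d) \sum_(k < d)
    tens [lie b`_j, [lie b`_k, b`_i]] (u i * (v j * w k)).
  under eq_bigr => i _ do rewrite exchange_big /=.
  rewrite exchange_big /=; apply: eq_bigr => i _; apply: eq_bigr => j _.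
  by apply: eq_bigr => k _; rewrite mulrA mulrC.
have -> : \sum_(i < d) \sum_(j < d) \sum_(k < d)
    tens [lie b`_i, [lie b`_j, b`_k]] (w i * (u j * v k)) =
  \sum_(i < d) \sum_(j < d) \sum_(k < d)
    tens [lie b`_k, [lie b`_i, b`_j]] (u i * (v j * w k)).
  rewrite exchange_big /=; apply: eq_bigr => i _; rewrite exchange_big /=.
  by apply: eq_bigr => j _; apply: eq_bigr => k _; rewrite mulrC -mulrA.
rewrite -!big_split big1 // => i _; rewrite -!big_split big1 // => j _.
rewrite -!big_split big1 // => k _ /=.
by rewrite -!(linear_funD (tens_linearl _)) /= lie_jacobi (linear_fun0 (tens_linearl _)).
Qed.

HB.instance Definition _ := isLie.Build K current
  current_lie_linearl current_lie_linearr current_liexx current_lie_jacobi.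

Lemma lie_tens (x y : L) (P Q : A) :
  [lie tens x P, tens y Q] = tens [lie x, y] (P * Q).
Proof. exact: current_lie_tens. Qed.

Section Restriction.
Variable V : lieModule current.

Let act1 (x : L) (w : V) : V := lact (tens x 1) w.

Fact act1_linearl w : linear (act1^~ w).
Proof. by move=> a x y; rewrite /act1 tens_linearl lact_linearl. Qed.

Fact act1_linearr x : linear (act1 x).
Proof. exact: lact_linearr. Qed.

Fact act1_lie x y w : act1 [lie x, y] w = act1 x (act1 y w) - act1 y (act1 x w).
Proof. by rewrite /act1 -lact_lie lie_tens mulr1. Qed.

(* The restriction of an L (x) A-module to L, identified with L (x) 1. *)
Definition restrict1 : lieModule L :=
  LieModule act1_linearl act1_linearr act1_lie.

End Restriction.

End Currents.

Section LocalWeylModules.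
Variables (K : numFieldType) (g : finLieAlgType K) (H : {vspace g}).
Variables (n_plus : {vspace g}) (h : 'I_(\dim H) -> subvs_of H).
Variables (M : affineVariety K) (Z : 'I_(\dim H) -> seq (point M)).

Definition weyl_generator (V : lieModule (current g M)) (v : V) :=
  [/\ integrable h (restrict1 V),
      generated_by v,
      forall x (P : coordRing M), x \in n_plus -> lact (tens x P) v = 0 &
      forall i (P : coordRing M),
        lact (tens (vsval (h i)) P) v = (\sum_(z <- Z i) P z) *: v].

Definition is_local_weyl_module (W : lieModule (current g M)) (v : W) :=
  weyl_generator v /\
  forall (V : lieModule (current g M)) (v' : V), weyl_generator v' ->
    exists phi : W -> V,
      [/\ module_morphism phi, phi v = v' & forall w', exists w, phi w = w'].

End LocalWeylModules.

(* Main.v *)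
Require Import Defs.
From HB Require Import structures.
From mathcomp Require Import all_boot all_order all_algebra.
From mathcomp Require Import boolp reals complex mpoly.

(** Choose [t] in [H] on which every simple root takes the value 1.  Each
    [f_i (x) P] lowers the eigenvalue of [t (x) 1] by 1, and integrability
    leaves only finitely many eigenvalues, so all sufficiently long words in the
    elements [f_i (x) P] act on [W] by zero ([integrable_words_vanish]).

    If [P] vanishes at all points of [Z i], then [h_i (x) PQ] kills [v] for
    every [Q], so that applying [e_i (x) P] to a word in the [f_i (x) Q_k]
    amounts to merging two of its letters into one, in all possible ways.
    Applying it [m] times to a word of length [m + 1] leaves a nonzero multiple
    of [f_i (x) P^m Q_0 ... Q_m]; hence [f_i (x) P^m Q] kills [v] once [m] is
    large ([act_f_power_vanish]).  With [P] a product of factors [x_m - c],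
    where [x_m] is a coordinate function, the elements [x] of [g] such that
    [x (x) PQ] kills [v] for some such product [P] and all [Q] form a subalgebra
    that contains all [e_i] and [f_i], so it is [g].  It follows that for every
    [m] some product [P] of factors [x_m - c] is such that [g (x) PA] acts by
    zero on all of [W] ([exists_annihilating_coord_prod]).  Since these products
    generate an ideal of finite codimension, for each [x] the elements [x (x) P]
    act through the finitely many ones where [P] is a product of partial Newton
    products ([act_newton_basis]).

    Finally, [W] is spanned by the words in the [f_i (x) P] applied to [v]: their
    span is stable under all [h_i (x) P], then under all [e_i (x) P], and the
    elements of [g] whose currents preserve it form a subalgebra
    ([lowering_ind]).  A finite alphabet and bounded length give the theorem.

    That [e_i] belongs to the nilradical of the positive Borel subalgebra is
    checked by showing that the positive root vectors span a nilpotent ideal of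
    it ([simple_root_vector_nilradical]). *)

Set Implicit Arguments.
Unset Strict Implicit.
Unset Printing Implicit Defensive.
Import Order.TTheory GRing.Theory Num.Theory.
Local Open Scope ring_scope.
Import VectorInternalTheory.

HB.instance Definition _ (K : pzRingType) (L : lieAlgType K) (x : L) :=
  GRing.isLinear.Build K L L *:%R (lie x) (lie_linearr x).

HB.instance Definition _ (K : fieldType) (L : lieAlgType K) (V : lieModule L)
    (x : L) :=
  GRing.isLinear.Build K V V *:%R (@lact K L V x) (lact_linearr x).

HB.instance Definition _ (K : numFieldType) (L : finLieAlgType K)
    (M : affineVariety K) (x : L) :=
  GRing.isLinear.Build K (coordRing M) (current L M) *:%R (tens x)
    (tens_linearr x).

(** * Linear algebra *)

(** Subspaces as predicates, so that quantified conditions define subspaces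
    directly. *)
Definition subspace (K : fieldType) (V : lmodType K) (S : V -> Prop) :=
  S 0 /\ forall a u w, S u -> S w -> S (a *: u + w).

Section Subspaces.
Variables (K : fieldType) (V : lmodType K) (S : V -> Prop).
Hypothesis subS : subspace S.

Lemma subspaceD u w : S u -> S w -> S (u + w).
Proof. by move=> Su Sw; rewrite -[u]scale1r; apply: subS.2. Qed.

Lemma subspaceZ a u : S u -> S (a *: u).
Proof. by move=> Su; rewrite -[_ *: _]addr0; apply: subS.2 => //; case: subS. Qed.

Lemma subspaceB u w : S u -> S w -> S (u - w).
Proof. by move=> Su Sw; rewrite -scaleN1r addrC; apply: subS.2. Qed.

Lemma subspace_sum I (r : seq I) (P : pred I) (F : I -> V) :
  (forall i, P i -> S (F i)) -> S (\sum_(i <- r | P i) F i).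
Proof. by move=> SF; elim/big_ind: _ => //; [case: subS|exact: subspaceD]. Qed.

End Subspaces.

Section LinearSpan.
Variables (K : fieldType) (V : lmodType K).

(** The linear span of [G], as the intersection of all subspaces containing [G]. *)
Definition lin_span (G : V -> Prop) (w : V) :=
  forall S : V -> Prop, subspace S -> (forall u, G u -> S u) -> S w.

Lemma lin_span_sub G : subspace (lin_span G).
Proof.
split=> [S [S0 _] _ //|a u w Gu Gw S subS GS].
by case: (subS) => _; apply; [exact: Gu|exact: Gw].
Qed.

Lemma mem_lin_span (G : V -> Prop) w : G w -> lin_span G w.
Proof. by move=> Gw S _; apply. Qed.

Lemma lin_span_preim (f : {linear V -> V}) (G : V -> Prop) (S : V -> Prop) :
  subspace S -> (forall u, G u -> S (f u)) -> forall w, lin_span G w -> S (f w).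
Proof.
move=> subS GS w Gw; apply: (Gw (fun w => S (f w))) => //; split=> [|a u u' Su Su'].
  by rewrite linear0; case: subS.
by rewrite linearP; apply: subS.2.
Qed.

End LinearSpan.

(** In finite dimension every subspace predicate is decided by a [{vspace V}],
    namely one of maximal dimension among those it contains. *)
Lemma subspace_vspace (K : fieldType) (V : vectType K) (S : V -> Prop) :
  subspace S -> exists U : {vspace V}, forall x, x \in U <-> S x.
Proof.
move=> subS.
pose p d := `[< exists U : {vspace V}, \dim U = d /\ forall x, x \in U -> S x >].
have p0 : exists d, p d.
  exists 0%N; apply/asboolP; exists 0%VS; split; first exact: dimv0.
  by move=> x; rewrite memv0 => /eqP->; case: subS.
have bd d : p d -> (d <= \dim {:V})%N.
  by move=> /asboolP[U [<- _]]; exact: dimvS (subvf U).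
have [d /asboolP[U [dU US]] dmax] := ex_maxnP p0 bd.
exists U => x; split=> [/US//|Sx].
apply/negP; rewrite memvE => /negP xU.
have : p (\dim (U + <[x]>)).
  apply/asboolP; exists (U + <[x]>)%VS; split=> // y /memv_addP[u /US Su].
  by case=> w /vlineP[k ->] ->; apply: subspaceD => //; exact: subspaceZ.
move/dmax; rewrite -dU => le_d; case: xU.
have eU : U = (U + <[x]>)%VS by apply/eqP; rewrite eqEdim addvSl.
by rewrite eU addvSr.
Qed.

Section LieIdentities.
Variables (K : numFieldType) (L : finLieAlgType K).
Implicit Types x y z : L.

Lemma lie_derivation x y z :
  [lie x, [lie y, z]] = [lie [lie x, y], z] + [lie y, [lie x, z]].
Proof.
have := lie_jacobi x y z; rewrite (lie_anti z x) linearN /= (lie_anti z) => /eqP.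
by rewrite subr_eq0 subr_eq => /eqP.
Qed.

Lemma subspace_lier (S : L -> Prop) y : subspace S -> subspace (fun x => S [lie x, y]).
Proof.
move=> subS; split=> [|a u w Su Sw].
  by rewrite (linear_fun0 (lie_linearl y)); case: subS.
by rewrite lie_linearl; apply: subS.2.
Qed.

Lemma subspace_liel (S : L -> Prop) x : subspace S -> subspace (fun y => S [lie x, y]).
Proof.
move=> subS; split=> [|a u w Su Sw]; first by rewrite linear0; case: subS.
by rewrite linearP; apply: subS.2.
Qed.

Lemma lie_prod_sub (U V X : {vspace L}) :
  (forall x y, x \in U -> y \in V -> [lie x, y] \in X) -> (lie_prod U V <= X)%VS.
Proof.
move=> UVX; apply/span_subvP => z /allpairsP[[x y] /= [xU yV ->]].
by apply: UVX; exact: vbasis_mem.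
Qed.

End LieIdentities.

Lemma poly_no_large_nat_root (K : numFieldType) (p : {poly K}) : p != 0 ->
  exists N, forall n, (N <= n)%N -> ~~ root p n%:R.
Proof.
have [m] := ubnP (size p); elim: m => // m IH in p *; rewrite ltnS => szp p0.
case: (pselect (exists n : nat, root p n%:R)) => [[n0 rp]|nr]; last first.
  by exists 0%N => n _; apply/negP => rn; apply: nr; exists n.
have [q qE] := factor_theorem p n0%:R rp.
have q0 : q != 0 by apply: contraNneq p0 => q0; rewrite qE q0 mul0r.
have [|N HN] := IH q _ q0.
  by move: szp; rewrite qE size_Mmonic ?monicXsubC // size_XsubC addn2.
exists (maxn N n0.+1) => n; rewrite geq_max => /andP[/HN qn lt_n].
by rewrite qE rootM negb_or qn root_XsubC eqr_nat gtn_eqF.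
Qed.

Lemma no_large_nat_mem (K : numFieldType) (s : seq K) :
  exists N, forall n, (N <= n)%N -> n%:R \notin s.
Proof.
have [|N HN] := @poly_no_large_nat_root K (\prod_(a <- s) ('X - a%:P)).
  by apply: monic_neq0; exact: monic_prod_XsubC.
by exists N => n /HN; rewrite root_prod_XsubC.
Qed.

(** The eigenvalues are among the roots of the characteristic polynomial. *)
Lemma no_large_nat_eigenvalue (K : numFieldType) (V : vectType K)
    (f : {linear V -> V}) :
  exists N, forall n x, (N <= n)%N -> f x = n%:R *: x -> x = 0.
Proof.
pose A := lin1_mx (v2r \o f \o r2v).
have [|N HN] := @poly_no_large_nat_root K (char_poly A).
  exact: monic_neq0 (char_poly_monic A).
exists N => n x /HN; rewrite -eigenvalue_root_char => nE fx.
apply/eqP; apply: contraNT nE => x0; apply/eigenvalueP; exists (v2r x).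
  by rewrite mul_rV_lin1 /= v2rK fx linearZ.
by apply: contra_neq x0 => vx0; apply: (can_inj v2rK); rewrite vx0 linear0.
Qed.

(** * Positive roots and the nilradical of the positive Borel subalgebra *)

Section PositiveRoots.
Variables (K : numFieldType) (L : finLieAlgType K) (H : {vspace L}).
Variable alpha : 'I_(\dim H) -> weight H.

(** The simple roots are linearly independent and as many as [\dim H], so their
    values at a point of [H] can be prescribed. *)
Lemma exists_height_element :
  free (codom alpha) -> exists t : subvs_of H, forall i, alpha i t = 1.
Proof.
move=> fr.
pose r2v' (x : 'rV[K]_(\dim H)) := @r2v _ (subvs_of H) x.
(* The matrix of the simple roots in the coordinates of [H]. *)
pose A := \matrix_(i < \dim H, j < \dim H)
  (alpha i (r2v' (delta_mx 0 j)) : K).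
have lin_r2v' : linear r2v' by move=> a x y; rewrite /r2v' linearP.
have AE i (x : 'rV_(\dim H)) : alpha i (r2v' x) = (x *m A^T) 0 i.
  rewrite [x in LHS]row_sum_delta (linear_fun_sum lin_r2v') linear_sum mxE.
  apply: eq_bigr => j _.
  by rewrite (linear_funZ lin_r2v') linearZ !mxE.
have uA : A \in unitmx.
  rewrite -row_free_unit -kermx_eq0; apply/rowV0P => u /sub_kermxP uA0.
  have fr' : free (codom_tuple alpha) by [].
  have /freeP/(_ (fun i => u 0 (cast_ord (card_ord _) i))) := fr'.
  have -> : \sum_(i < #|'I_(\dim H)|)
       u 0 (cast_ord (card_ord _) i) *: (codom_tuple alpha)`_i = 0.
    apply/lfunP => t; rewrite sum_lfunE lfunE /=.
    have := congr1 (fun w : 'rV_(\dim H) => (w *m (v2r t)^T) 0 0) uA0.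
    rewrite mul0mx -mulmxA !mxE => uAt.
    rewrite -[RHS]uAt (reindex (cast_ord (esym (card_ord (\dim H))))) /=.
      2: by apply: onW_bij; exists (cast_ord (card_ord _));
        [exact: cast_ordKV|exact: cast_ordK].
    apply: eq_bigr => i _; rewrite lfunE /= cast_ordKV; congr (_ * _).
    have -> : (codom alpha)`_i = alpha i.
      rewrite (nth_map i) ?size_enum_ord //; congr alpha.
      by apply: val_inj; rewrite /= nth_enum_ord.
    rewrite -[t]v2rK AE.
    by rewrite v2rK !mxE; apply: eq_bigr => j _; rewrite !mxE mulrC.
  move=> /(_ erefl) u0; apply/rowP => i; rewrite mxE.
  by have := u0 (cast_ord (esym (card_ord _)) i); rewrite cast_ordKV.
exists (r2v' (const_mx 1 *m (invmx A)^T)) => i.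
by rewrite AE -mulmxA -trmx_mul mulmxV // trmx1 mulmx1 mxE.
Qed.

Lemma root_vector_lie (beta gamma : weight H) x y :
  root_vector beta x -> root_vector gamma y ->
  root_vector (beta + gamma) [lie x, y].
Proof.
move=> bx gy t; rewrite lie_derivation bx gy linearZ /= lfunE /= scalerDl.
by rewrite (linear_funZ (lie_linearl y)).
Qed.

Lemma sum_weight_height (t : subvs_of H) (k : 'I_(\dim H) -> nat) :
  (forall i, alpha i t = 1) ->
  (\sum_i alpha i *+ k i) t = (\sum_i k i)%:R.
Proof.
move=> t1; rewrite sum_lfunE natr_sum; apply: eq_bigr => i _.
by rewrite -scaler_nat lfunE /= t1 -[RHS]mulr1.
Qed.

(** Root vectors whose weight is a nonnegative combination of simple roots of
    height greater than [n]; the zero vector counts as one. *)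
Definition height_vector n (x : L) :=
  exists k : 'I_(\dim H) -> nat,
    (n < \sum_i k i)%N /\ root_vector (\sum_i alpha i *+ k i) x.

Definition height_span n := lin_span (height_vector n).

Lemma height_span_lie m n x y :
  height_span m x -> height_span n y -> height_span (m + n).+1 [lie x, y].
Proof.
move=> mx ny; have subS := lin_span_sub (height_vector (m + n).+1).
apply: (mx (fun x => height_span _ [lie x, y]) (subspace_lier y subS)) => u [k [mk ku]].
apply: (ny _ (subspace_liel u subS)) => w [l [nl lw]].
apply: mem_lin_span; exists (fun i => k i + l i)%N; split.
  by rewrite big_split /= -addSn -addnS leq_add.
under eq_bigr => i _ do rewrite mulrnDr.
by rewrite big_split; exact: root_vector_lie.
Qed.

Lemma height_span_lie_cartan n (s : subvs_of H) x :
  height_span n x -> height_span n [lie vsval s, x].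
Proof.
have subS := lin_span_sub (height_vector n).
move=> nx; apply: (nx _ (subspace_liel _ subS)) => u [k [nk ku]].
by rewrite ku; apply: (subspaceZ subS); apply: mem_lin_span; exists k.
Qed.

(** The height of a root is an eigenvalue of [ad t], where all simple roots take
    the value 1 at [t]. *)
Lemma height_span_vanish (t : subvs_of H) : (forall i, alpha i t = 1) ->
  exists n, forall x, height_span n x -> x = 0.
Proof.
move=> t1; have [n Hn] := no_large_nat_eigenvalue (lie (vsval t)).
exists n => x nx; apply: (nx (fun x => x = 0)) => [|u [k [/ltnW nk ku]]].
  by split=> // a u w -> ->; rewrite scaler0 addr0.
by apply: Hn nk _; rewrite -(sum_weight_height k t1); exact: ku.
Qed.

(** The span of the positive root vectors is an ideal of the positive Borel
    subalgebra; it is nilpotent, as each bracket increases the height and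
    heights are bounded. *)
Lemma simple_root_vector_nilradical (b_plus n_plus : {vspace L}) i x :
  simple_roots alpha -> is_positive_borel alpha b_plus ->
  is_nilradical b_plus n_plus -> root_vector (alpha i) x -> x \in n_plus.
Proof.
move=> [rt fr sr] [[Hb rb] bmin] [_ _ nmax] aix.
have [t t1] := exists_height_element fr.
have sub n := lin_span_sub (height_vector n).
have [N NE] := subspace_vspace (sub 0%N).
suff /subvP : (N <= n_plus)%VS.
  apply; apply/NE; apply: mem_lin_span; exists (fun j => (j == i) : nat).
  rewrite (bigD1 i) //= eqxx; split=> //.
  rewrite (bigD1 i) //= eqxx big1 ?addr0 // => j /negPf ->.
  by rewrite mulr0n.
have bN : (b_plus <= H + N)%VS.
  apply: bmin; split=> [|beta y [[b0 _] [k kE]] by_]; first exact: addvSl.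
  apply: (subvP (addvSr H N)); apply/NE; apply: mem_lin_span; exists k.
  split; last by rewrite -kE.
  rewrite lt0n; apply: contraNneq b0 => k0; rewrite kE big1 // => j _.
  have /eqP := k0; rewrite sum_nat_eq0 => /forallP/(_ j)/implyP/(_ isT)/eqP ->.
  by rewrite mulr0n.
have Nb : (N <= b_plus)%VS.
  apply/subvP => y /NE yN; apply: (yN (fun y => y \in b_plus)).
    by split=> [|a u w ub wb]; [exact: mem0v|rewrite rpredD ?rpredZ].
  move=> u [k [k0 ku]].
  have [->|u0] := eqVneq u 0; first exact: mem0v.
  apply: (rb _ _ _ ku); split; last by exists k.
  split; last by exists u.
  apply/eqP => s0; have := sum_weight_height k t1; rewrite s0 lfunE /= => /esym/eqP.
  by rewrite pnatr_eq0 -leqn0 leqNgt k0.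
apply: nmax.
- split=> // y z /(subvP bN)/memv_addP[u uH [w wN ->]] zN; apply/NE.
  rewrite (linear_funD (lie_linearl z)); apply: (subspaceD (sub 0%N)).
    by have := @height_span_lie_cartan 0%N (Sub u uH) z; apply; apply/NE.
  move/NE in wN; move/NE in zN.
  apply: (height_span_lie wN zN (sub 0%N)).
  by move=> a [k [k0 ka]]; apply: mem_lin_span; exists k; split=> //; exact: ltn_trans k0.
- have [n nE] := height_span_vanish t1; exists n.
  have lcs m y : y \in lower_central_series N m -> height_span m y.
    elim: m y => [|m IH] y; first by move/NE.
    have [U UE] := subspace_vspace (sub m.+1).
    move=> yL; apply/UE; apply: subvP yL.
    by apply: lie_prod_sub => a c /NE aN /IH cN; apply/UE; exact: (height_span_lie aN).
  by apply/eqP; rewrite -subv0; apply/subvP => y /lcs/nE ->; exact: mem0v.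
Qed.

End PositiveRoots.

(** * Coordinate functions on an affine variety *)

Section CoordinateFunctions.
Variables (K : numFieldType) (M : affineVariety K).
Local Notation A := (coordRing M).
Local Notation n := (ambient_dim M).

Lemma polyfun_regular (p : {mpoly K[n]}) : polyfun p \in @regular K M.
Proof. by apply/asboolP; exists p. Qed.

(** The regular function defined by a polynomial. *)
Definition coord_poly (p : {mpoly K[n]}) : A := CoordRing (polyfun_regular p).

(** The [m]-th coordinate function. *)
Definition coord_fn (m : 'I_n) : A := coord_poly 'X_m.

Lemma coord_poly_linear : linear coord_poly.
Proof.
move=> a p q; apply/val_inj/funext => z /=.
by rewrite /polyfun mevalD mevalZ.
Qed.

Lemma coord_polyM p q : coord_poly (p * q) = coord_poly p * coord_poly q.
Proof. by apply/val_inj/funext => z /=; rewrite /polyfun mevalM. Qed.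

Lemma coord_poly1 : coord_poly 1 = 1.
Proof. by apply/val_inj/funext => z /=; rewrite /polyfun meval1. Qed.

(** The coordinate functions generate the coordinate ring. *)
Lemma coordRing_ind (S : A -> Prop) : subspace S -> S 1 ->
  (forall m P, S P -> S (coord_fn m * P)) -> forall P, S P.
Proof.
move=> subS S1 Sx P.
suff Sp p Q : S Q -> S (coord_poly p * Q).
  have /asboolP[p pE] := valP P; rewrite -[P]mulr1.
  have -> : P = coord_poly p by apply/val_inj; rewrite /= -pE.
  exact: Sp.
move=> SQ; rewrite [p]mpolyE (linear_fun_sum coord_poly_linear) mulr_suml.
apply: (subspace_sum subS) => m _; rewrite (linear_funZ coord_poly_linear) -coordZAl.
apply: (subspaceZ subS); rewrite mpolyXE_id.
elim/big_rec: _ => [|i q _ IH]; first by rewrite coord_poly1 mul1r.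
rewrite coord_polyM -mulrA; elim: (m i) => [|k IHk].
  by rewrite expr0 coord_poly1 mul1r.
by rewrite exprS coord_polyM -mulrA; exact: Sx.
Qed.

(** The product of the functions [x_m - a] for [a] in [s]. *)
Definition coord_prod (m : 'I_n) (s : seq K) : A :=
  \prod_(a <- s) (coord_fn m - a *: (1 : A)).

Lemma coord_prod_root m (s : seq K) (z : point M) :
  sval z ord0 m \in s -> coord_prod m s z = 0.
Proof.
elim: s => // a s IH; rewrite inE => zs.
have -> : coord_prod m (a :: s) z = (sval z ord0 m - a) * coord_prod m s z.
  transitivity ((coord_fn m z - a * 1) * coord_prod m s z).
    by rewrite /coord_prod big_cons.
  by rewrite /= /polyfun mevalXU mulr1.
by case/orP: zs => [/eqP ->|/IH ->]; rewrite ?subrr ?mul0r ?mulr0.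
Qed.

Lemma coord_prod_cat m s s' :
  coord_prod m (s ++ s') = coord_prod m s * coord_prod m s'.
Proof. exact: big_cat. Qed.

Lemma coord_prod_exp m s r : exists s', coord_prod m s' = coord_prod m s ^+ r.
Proof.
elim: r => [|r [s' IH]]; first by exists [::]; rewrite /coord_prod big_nil.
by exists (s ++ s'); rewrite exprS -IH coord_prod_cat.
Qed.

End CoordinateFunctions.

(** * Modules over current algebras *)

Section CurrentAction.
Variables (K : numFieldType) (g : finLieAlgType K) (M : affineVariety K).
Variable W : lieModule (current g M).
Local Notation A := (coordRing M).
Local Notation act x P := (@lact _ _ W (tens x P)).

Lemma act_lie x y (P Q : A) w :
  act [lie x, y] (P * Q) w = act x P (act y Q w) - act y Q (act x P w).
Proof. by rewrite -lact_lie lie_tens. Qed.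

Lemma act_swap x y (P Q : A) w :
  act x P (act y Q w) = act y Q (act x P w) + act [lie x, y] (P * Q) w.
Proof. by rewrite act_lie addrC subrK. Qed.

Lemma act_linearl (P : A) w : linear (fun x => act x P w).
Proof. by move=> a x y; rewrite tens_linearl lact_linearl. Qed.

Lemma act_linearm x w : linear (fun P : A => act x P w).
Proof. by move=> a P Q; rewrite linearP lact_linearl. Qed.

(** No proper subalgebra of [g] contains [X]. *)
Definition generates (X : g -> Prop) :=
  forall U : {vspace g}, lie_subalgebra U -> (forall x, X x -> x \in U) ->
  U = fullv.

Lemma generates_ind (X S : g -> Prop) :
  generates X -> subspace S ->
  (forall x y, S x -> S y -> S [lie x, y]) -> (forall x, X x -> S x) ->
  forall x, S x.
Proof.
move=> gen subS Slie XS x; have [U UE] := subspace_vspace subS.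
apply/UE; rewrite (gen U) ?memvf // => [y z /UE Sy /UE Sz|y /XS Sy]; apply/UE => //.
exact: Slie.
Qed.

(** The bracket of [x (x) P] and [y (x) 1] is that of [x] and [y] tensored with
    [P], so the elements of [g] all of whose currents preserve [T] form a
    subalgebra; hence it is enough to test generators of [g]. *)
Lemma stable_under_currents (X : g -> Prop) (T : W -> Prop) :
  generates X -> subspace T ->
  (forall x P w, X x -> T w -> T (act x P w)) -> forall x P w, T w -> T (act x P w).
Proof.
move=> gen subT XT x P w Tw; move: x P w Tw.
apply: (generates_ind gen (S := fun x => forall P w, T w -> T (act x P w))).
- split=> [|a x y Tx Ty] P w Tw.
    by rewrite (linear_fun0 (act_linearl P w)); case: subT.
  by rewrite act_linearl; apply: subT.2; [exact: Tx|exact: Ty].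
- move=> x y Tx Ty P w Tw; rewrite -[P]mulr1 act_lie.
  by apply: (subspaceB subT); [apply/Tx/Ty|apply/Ty/Tx].
- by move=> x Xx P w; exact: XT.
Qed.

Lemma submodule_full (v : W) (T : W -> Prop) : generated_by v ->
  subspace T -> T v -> (forall x P w, T w -> T (act x P w)) -> forall w, T w.
Proof.
move=> gen subT Tv Tact; apply: gen => //; first exact: subT.2.
move=> u w Tw; rewrite [u]tens_coord.
rewrite (linear_fun_sum (lact_linearl w)).
by apply: (subspace_sum subT) => i _; exact: Tact.
Qed.

(** ** Merging letters in a copy of sl2 *)

Section LoweringWords.
Variables (e hh f : g) (v : W).
Hypotheses (ef : [lie e, f] = hh) (hf : [lie hh, f] = - (2%:R *: f)).

(** [f (x) Q_1 ... f (x) Q_k] applied to [v], for [s] the list of the [Q_j]. *)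
Definition lowering_word (s : seq A) : W := foldr (fun Q w => act f Q w) v s.

(** The lists obtained from [s] by multiplying one entry by [R]. *)
Fixpoint bumps (R : A) (s : seq A) : seq (seq A) :=
  if s is Q :: s' then ((R * Q) :: s') :: [seq Q :: u | u <- bumps R s']
  else [::].

(** The lists obtained from [s] by replacing two entries by one, their product
    with [P]. *)
Fixpoint merges (P : A) (s : seq A) : seq (seq A) :=
  if s is Q :: s' then bumps (P * Q) s' ++ [seq Q :: u | u <- merges P s']
  else [::].

Lemma size_bumps R s : size (bumps R s) = size s.
Proof. by elim: s => //= Q s IH; rewrite size_map IH. Qed.

Lemma size_merges P s : size (merges P s) = 'C(size s, 2).
Proof.
elim: s => //= Q s IH.
by rewrite size_cat size_map IH size_bumps binS bin1 addnC.
Qed.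

Lemma bumpsP R s u : u \in bumps R s ->
  size u = size s /\ \prod_(Q <- u) Q = R * \prod_(Q <- s) Q.
Proof.
elim: s u => //= Q s IH u; rewrite inE => /orP[/eqP ->|/mapP[u' /IH[sz pr] ->]] /=.
  by rewrite !big_cons mulrA.
by rewrite !big_cons sz pr mulrCA.
Qed.

Lemma mergesP P s u : u \in merges P s ->
  (size u).+1 = size s /\ \prod_(Q <- u) Q = P * \prod_(Q <- s) Q.
Proof.
elim: s u => //= Q s IH u.
rewrite mem_cat => /orP[/bumpsP[sz pr]|/mapP[u' /IH[sz pr] ->]] /=.
  by rewrite sz pr big_cons mulrA.
by rewrite !big_cons sz pr mulrCA.
Qed.

Lemma act_lowering_word_cons Q s : lowering_word (Q :: s) = act f Q (lowering_word s).
Proof. by []. Qed.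

Lemma act_sum_cons (Q : A) (l : seq (seq A)) :
  act f Q (\sum_(u <- l) lowering_word u) =
  \sum_(u <- [seq Q :: u | u <- l]) lowering_word u.
Proof. by rewrite linear_sum big_map. Qed.

Lemma act_h_lowering_word R s : (act hh R v = 0) ->
  act hh R (lowering_word s) = - 2%:R *: \sum_(u <- bumps R s) lowering_word u.
Proof.
move=> hR; elim: s => [|Q s IH]; first by rewrite big_nil scaler0.
rewrite act_lowering_word_cons act_swap IH hf big_cons scalerDr -act_sum_cons.
rewrite linearZ /= addrC; congr (_ + _).
rewrite (linear_funN (act_linearl _ _)) (linear_funZ (act_linearl _ _)).
by rewrite scaleNr.
Qed.

Variable P : A.
Hypothesis eP : act e P v = 0.
Hypothesis hP : forall Q, act hh (P * Q) v = 0.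

Lemma act_e_lowering_word s :
  act e P (lowering_word s) = - 2%:R *: \sum_(u <- merges P s) lowering_word u.
Proof.
elim: s => [|Q s IH]; first by rewrite big_nil scaler0.
rewrite act_lowering_word_cons act_swap IH ef act_h_lowering_word // big_cat scalerDr /=.
by rewrite -act_sum_cons linearZ /= addrC.
Qed.

(** The multiple does not depend on the word: after [m] mergings of [m + 1]
    letters, every term is the single letter [P ^+ m] times the product of all. *)
Lemma iter_act_e_lowering_word m : exists2 c : K, c != 0 &
  forall s, size s = m.+1 ->
  iter m (act e P) (lowering_word s) = c *: act f (P ^+ m * \prod_(Q <- s) Q) v.
Proof.
elim: m => [|m [c c0 IH]].
  exists 1; rewrite ?oner_eq0 // => -[|Q [|]] // _.
  by rewrite big_seq1 mul1r scale1r.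
(* Each step contributes a factor [- 2] for each pair of letters. *)
exists (c * - 2%:R * 'C(m.+2, 2)%:R).
  rewrite !mulf_neq0 ?oppr_eq0 ?pnatr_eq0 // -lt0n bin_gt0 //.
move=> s szs; rewrite iterSr act_e_lowering_word.
have lin_it : linear (iter m (act e P)).
  by elim: (m) => [|k IHk] a u w //=; rewrite IHk linearP.
rewrite (linear_funZ lin_it) (linear_fun_sum lin_it).
rewrite (eq_big_seq (fun=> c *: act f (P ^+ m.+1 * \prod_(Q <- s) Q) v)); last first.
  move=> u /mergesP[szu pu]; rewrite IH ?pu ?mulrA -?exprSr //.
  by apply: succn_inj; rewrite szu.
rewrite big_const_seq count_predT size_merges szs iter_addr_0 -scaler_nat !scalerA.
by rewrite [_ * c]mulrC mulrA [- _ * c]mulrC.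
Qed.

(** Apply the previous lemma to the word with letters [Q, 1, ..., 1]. *)
Lemma act_f_power_vanish m :
  (forall s, size s = m.+1 -> lowering_word s = 0) ->
  forall Q, act f (P ^+ m * Q) v = 0.
Proof.
move=> f0 Q; have [c c0 /(_ (Q :: nseq m 1))] := iter_act_e_lowering_word m.
rewrite f0 /= ?size_nseq // big_cons big1_seq ?mulr1; last first.
  by move=> i; rewrite mem_nseq => /andP[_ /andP[_ /eqP]].
have -> : iter m (act e P) 0 = 0 by elim: (m) => //= k ->; rewrite linear0.
by move=> /(_ erefl)/esym/eqP; rewrite scaler_eq0 (negPf c0) => /eqP.
Qed.

End LoweringWords.

(** ** Integrability *)

(** Words in arbitrary elements [x (x) P], applied to [w]. *)
Definition word (s : seq (g * A)) (w : W) : W :=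
  foldr (fun q u => act q.1 q.2 u) w s.

Lemma linear_word s : linear (word s).
Proof. by elim: s => [|q s IH] a u w //=; rewrite IH linearP. Qed.

Section Integrability.
Variables (H : {vspace g}) (h : 'I_(\dim H) -> subvs_of H).
Variable t : subvs_of H.
Hypothesis intW : integrable h (restrict1 W).

(** The operator [t (x) 1] has finitely many eigenvalues on [W], and its
    eigenvectors span [W]. *)
Lemma integrable_spectrum : exists E : seq K,
  (forall a w, act (vsval t) 1 w = a *: w -> a \notin E -> w = 0) /\
  (forall S : W -> Prop, subspace S ->
     (forall a w, a \in E -> act (vsval t) 1 w = a *: w -> S w) ->
   forall w, S w).
Proof.
have [D [_ _ dec dir]] := intW.
pose ev (mu : weight H) : K := mu t.
exists (map ev D); split=> [a w ew aD|S subS ES w]; last first.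
  have [c [wc ->]] := dec w; rewrite big_seq; apply: (subspace_sum subS) => mu muD.
  by apply: (ES (ev mu)); [exact: map_f | exact: (wc mu muD t)].
have [c [wc wE]] := dec w.
have Z : \sum_(mu <- D) (ev mu - a) *: c mu = 0.
  have /eqP := ew; rewrite wE -subr_eq0 linear_sum scaler_sumr -sumrB => /eqP e0.
  rewrite -[RHS]e0 [LHS]big_seq [RHS]big_seq.
  by apply: eq_bigr => mu muD; rewrite scalerBl; congr (_ - _); rewrite -(wc mu muD t).
rewrite wE big_seq big1 // => mu muD.
have wv nu : nu \in D -> weight_vector nu ((ev nu - a) *: c nu).
  move=> nuD s; have es : act (vsval s) 1 (c nu) = nu s *: c nu := wc nu nuD s.
  by rewrite /lact /= linearZ /= es !scalerA mulrC.
have /eqP := dir _ wv Z mu muD; rewrite scaler_eq0 subr_eq0.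
move=> /orP[/eqP mt|/eqP //].
by case/negP: aD; rewrite -mt; apply/mapP; exists mu.
Qed.

(** Each letter lowers the eigenvalue of [t] by 1, which leaves the finite
    spectrum after enough steps. *)
Lemma integrable_words_vanish : exists N, forall s w, (N <= size s)%N ->
  (forall q, q \in s -> [lie vsval t, q.1] = - q.1) -> word s w = 0.
Proof.
have [E [E0 Egen]] := integrable_spectrum.
have [N HN] := no_large_nat_mem [seq a - b | a <- E, b <- E].
exists N => s w /HN nE low; apply: (Egen (fun w => word s w = 0)) => [|a u aE ua].
  have ls := linear_word s.
  split=> [|b u1 u2]; first exact: linear_fun0 ls.
  by rewrite ls => -> ->; rewrite scaler0 addr0.
have ews : act (vsval t) 1 (word s u) = (a - (size s)%:R) *: word s u.
  elim: s low {nE} => [|q s IH] low; first by rewrite /= subr0.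
  rewrite /= act_swap mul1r low ?mem_head // IH; last first.
    by move=> p ps; apply: low; rewrite inE ps orbT.
  rewrite linearZ /= (linear_funN (act_linearl _ _)) -[X in _ - X]scale1r -scalerBl.
  by rewrite -addrA -opprD -natr1.
apply: E0 ews _; apply: contra nE => asE; apply/allpairsP.
by exists (a, a - (size s)%:R); split=> //=; rewrite opprB addrC subrK.
Qed.

End Integrability.

(** ** Reduction to finitely many currents *)

(** [g (x) PA] acts by zero. *)
Definition annihilates (P : A) := forall x Q w, act x (P * Q) w = 0.

Lemma annihilates_sub : subspace annihilates.
Proof.
split=> [|a P Q aP aQ] x R w.
  by rewrite mul0r linear0 (linear_fun0 (lact_linearl w)).
by rewrite mulrDl -coordZAl act_linearm aP aQ scaler0 addr0.
Qed.

Lemma annihilatesM P Q : annihilates P -> annihilates (P * Q).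
Proof. by move=> aP x R w; rewrite -mulrA. Qed.

Lemma annihilates_eq P Q x w : annihilates (P - Q) -> act x P w = act x Q w.
Proof.
move=> /(_ x 1 w); rewrite mulr1 => PQ0; apply/eqP; rewrite -subr_eq0; apply/eqP.
by rewrite -[RHS]PQ0 addrC -scaleN1r -act_linearm scaleN1r addrC.
Qed.

Section FiniteQuotient.
Local Notation n := (ambient_dim M).
Variable s : 'I_n -> seq K.
Hypothesis s0 : forall m, annihilates (coord_prod m (s m)).

(** The partial products of [coord_prod m (s m)]: the Newton polynomials in [x_m]
    with nodes [s m].  Beyond the length of [s m] the nodes are 0. *)
Definition newton_factor (m : 'I_n) (j : nat) : A :=
  coord_prod m [seq nth 0 (s m) k | k <- iota 0 j].

(** Newton polynomials in all variables; unlike monomials, they make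
    multiplication by [x_m] lower-triangular without any expansion. *)
Definition newton (a : 'I_n -> nat) : A := \prod_m newton_factor m (a m).

Lemma newton_factorS m j :
  newton_factor m j.+1 = newton_factor m j * (coord_fn m - (s m)`_j *: (1 : A)).
Proof. by rewrite /newton_factor -addn1 iotaD map_cat /coord_prod big_cat big_seq1. Qed.

Lemma annihilates_newton_factor m j :
  (size (s m) <= j)%N -> annihilates (newton_factor m j).
Proof.
move=> /subnKC <-; rewrite /newton_factor iotaD map_cat /coord_prod big_cat.
by rewrite map_nth_iota0 // take_size; apply: annihilatesM; exact: s0.
Qed.

Lemma coord_fn_newton m a : exists b, coord_fn m * newton a =
  (s m)`_(a m) *: newton a + newton b.
Proof.
exists (fun k => if k == m then (a m).+1 else a k).
rewrite /newton (bigD1 m) //= [X in _ = _ + X](bigD1 m) //= eqxx newton_factorS.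
rewrite [X in _ = _ + _ * X](eq_bigr (fun k => newton_factor k (a k))); last first.
  by move=> k /negPf ->.
rewrite mulrBr mulrBl [newton_factor m (a m) * coord_fn m]mulrC mulrA.
rewrite [newton_factor _ _ * (_ *: (1 : A))]mulrC -coordZAl mul1r -coordZAl.
by rewrite addrC subrK.
Qed.

(** The Newton polynomials of bounded multidegree; all the others annihilate. *)
Definition newton_basis : seq A :=
  let D := (\max_m size (s m)).+1 in
  [seq newton (fun m => a m) | a : {ffun 'I_n -> 'I_D}].

(** The functions that lie in the span of [newton_basis] up to annihilating ones. *)
Definition newton_span (P : A) := exists P',
  lin_span (fun b => b \in newton_basis) P' /\ annihilates (P - P').

Lemma newton_span_sub : subspace newton_span.
Proof.
have subA := annihilates_sub; have subL := lin_span_sub (fun b => b \in newton_basis).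
split=> [|a P Q [P' [lP aP]] [Q' [lQ aQ]]].
  by exists 0; rewrite subrr; split; [case: subL | case: subA].
exists (a *: P' + Q'); split; first exact: subL.2.
have -> : a *: P + Q - (a *: P' + Q') = a *: (P - P') + (Q - Q').
  by rewrite opprD addrACA scalerBr.
exact: subA.2.
Qed.

Lemma newton_span_newton a : newton_span (newton a).
Proof.
have subL := lin_span_sub (fun b => b \in newton_basis).
case: (pselect (exists m, size (s m) <= a m)%N) => [[m sm]|all_lt].
  exists 0; rewrite subr0; split; first by case: subL.
  by rewrite /newton (bigD1 m) //=; apply/annihilatesM/annihilates_newton_factor.
exists (newton a); rewrite subrr; split; last by case: annihilates_sub.
apply: mem_lin_span; apply/mapP.
exists [ffun m => inord (a m)]; first by rewrite mem_enum.
apply: eq_bigr => m _; rewrite ffunE inordK // ltnS.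
apply: leq_trans (leq_bigmax m); rewrite leqNgt; apply/negP => sm.
by apply: all_lt; exists m; exact: ltnW.
Qed.

(** The coordinate ring is finite-dimensional modulo annihilating functions. *)
Lemma newton_span_full P : newton_span P.
Proof.
apply: coordRing_ind P; first exact: newton_span_sub.
  rewrite (_ : 1 = newton (fun=> 0%N)); first exact: newton_span_newton.
  by rewrite /newton big1 // => m _; rewrite /newton_factor /coord_prod big_nil.
move=> m P [P' [lP aP]].
suff [Q [lQ aQ]] : newton_span (coord_fn m * P').
  exists Q; split=> //; rewrite -[X in X - Q](subrK (coord_fn m * P')) -addrA.
  by apply: (subspaceD annihilates_sub) => //; rewrite -mulrBr mulrC; exact: annihilatesM.
have subN := newton_span_sub.
apply: (lP (fun Q => newton_span (coord_fn m * Q))) => [|_ /mapP[a _ ->]].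
  split=> [|a Q R sQ sR]; first by rewrite mulr0; case: subN.
  by rewrite mulrDr mulrC -coordZAl mulrC; apply: subN.2 => //; rewrite mulrC.
have [b ->] := coord_fn_newton m (fun m => a m).
by apply: subN.2; exact: newton_span_newton.
Qed.

Lemma act_newton_basis x P w :
  lin_span (fun u => exists2 b, b \in newton_basis & u = act x b w) (act x P w).
Proof.
have [P' [lP /annihilates_eq ->]] := newton_span_full P.
set G := fun u => _; have subG := lin_span_sub G.
apply: (lP (fun P' => lin_span G (act x P' w))) => [|b bB].
  split=> [|a Q R GQ GR]; first by rewrite (linear_fun0 (act_linearm x w)); case: subG.
  by rewrite act_linearm; apply: subG.2.
by apply: mem_lin_span; exists b.
Qed.

End FiniteQuotient.

(** * Finite dimensionality of highest weight modules *)

Section LoweringSpan.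
Variables (r : nat) (e hh f : 'I_r -> g) (a : 'I_r -> 'I_r -> K).
Hypothesis ef : forall i j, [lie e i, f j] = if i == j then hh i else 0.
Hypothesis hf : forall i j, [lie hh i, f j] = - (a i j *: f j).
Hypothesis gen : generates (fun x => exists i, x = e i \/ x = f i).
Variable v : W.
Hypothesis genv : generated_by v.
Hypothesis ev : forall i P, act (e i) P v = 0.

(** [W] is spanned by the words in the [f i (x) P] applied to [v]. *)
Lemma lowering_ind (T : W -> Prop) :
  (forall i P, exists c, act (hh i) P v = c *: v) ->
  subspace T -> T v -> (forall i P w, T w -> T (act (f i) P w)) -> forall w, T w.
Proof.
move=> hv subT Tv Tf.
(* The span of these words. *)
pose LS w := forall S : W -> Prop, subspace S -> S v ->
  (forall i P u, S u -> S (act (f i) P u)) -> S w.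
suff LSfull w : LS w by move=> w; exact: LSfull.
have subL : subspace LS.
  split=> [S [] //|b u u' Lu Lu' S subS Sv Sf].
  by apply: subS.2; [exact: Lu|exact: Lu'].
have Lv : LS v by move=> S.
have Lf i P u : LS u -> LS (act (f i) P u).
  by move=> Lu S subS Sv Sf; apply: (Sf); exact: Lu.
have subLact x : subspace (fun u => LS u /\ forall P, LS (act x P u)).
  split=> [|b u u' [Lu xu] [Lu' xu']].
    by split=> [|P]; [case: subL|rewrite linear0; case: subL].
  split=> [|P]; first exact: (subL.2 b _ _ Lu Lu').
  by rewrite linearP; exact: (subL.2 b _ _ (xu P) (xu' P)).
have Lh i P u : LS u -> LS (act (hh i) P u).
  move=> Lu; pose T' w := LS w /\ forall P, LS (act (hh i) P w).
  apply: (Lu T' (subLact _) _ _).2.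
    by split=> // Q; have [c ->] := hv i Q; apply: (subspaceZ subL).
  move=> j Q {Lu}u [Lu hu]; split=> [|R]; first exact: Lf.
  rewrite act_swap hf (linear_funN (act_linearl _ _)) (linear_funZ (act_linearl _ _)).
  by apply: (subspaceB subL); [exact: Lf|apply: (subspaceZ subL); exact: Lf].
have Le i P u : LS u -> LS (act (e i) P u).
  move=> Lu; pose T' w := LS w /\ forall P, LS (act (e i) P w).
  apply: (Lu T' (subLact _) _ _).2.
    by split=> // Q; rewrite ev; case: subL.
  move=> j Q {Lu}u [Lu hu]; split=> [|R]; first exact: Lf.
  rewrite act_swap ef; apply: (subspaceD subL); first exact: Lf.
  case: ifP => _; first exact: Lh.
  by rewrite (linear_fun0 (act_linearl _ _)); case: subL.
apply: (submodule_full genv subL Lv); apply: (stable_under_currents gen subL).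
by move=> x P u [i [->|->]]; [exact: Le|exact: Lf].
Qed.

Variable Z : 'I_r -> seq (point M).
Hypothesis a2 : forall i, a i i = 2%:R.
Hypothesis hv : forall i P, act (hh i) P v = (\sum_(z <- Z i) P z) *: v.
Variable N : nat.
Hypothesis words0 : forall s w, (N <= size s)%N ->
  (forall q, q \in s -> exists i, q.1 = f i) -> word s w = 0.

(** The product of the [x_m - x_m(z)], for [z] in [Z i], vanishes on [Z i]; its
    [N]-th power is again a product of such factors. *)
Lemma lowering_vector_annihilated i m : exists s, forall Q,
  act (f i) (coord_prod m s * Q) v = 0.
Proof.
pose crd (z : point M) : K := sval z ord0 m.
pose s := map crd (Z i).
have [s' s'E] := coord_prod_exp m s N; exists s' => Q; rewrite s'E.
have eff : [lie e i, f i] = hh i by rewrite ef eqxx.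
have hff : [lie hh i, f i] = - (2%:R *: f i) by rewrite hf a2.
apply: (act_f_power_vanish eff hff (ev i _)) => [R|l szl].
  suff sum0 (l : seq (point M)) : {subset map crd l <= s} ->
      \sum_(z <- l) (coord_prod m s * R) z = 0 by rewrite hv sum0 ?scale0r.
  elim: l => [|z l IH] ls; first by rewrite big_nil.
  rewrite big_cons IH ?addr0 => [|b bl]; last by apply: ls; rewrite inE bl orbT.
  transitivity (coord_prod m s z * R z) => //.
  by rewrite coord_prod_root ?mul0r // ls ?mem_head.
have -> : lowering_word (f i) v l = word [seq (f i, P) | P <- l] v.
  by elim: l {szl} => //= P l ->.
apply: words0 => [|q /mapP[P _ ->]]; last by exists i.
by rewrite size_map szl.
Qed.

Lemma exists_annihilating_coord_prod m : exists s, annihilates (coord_prod m s).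
Proof.
(* A subalgebra, because the lists [s] can be concatenated. *)
pose S x := exists s, forall Q, act x (coord_prod m s * Q) v = 0.
have Sfull : forall x, S x.
  apply: (generates_ind gen).
  - split=> [|b x y [s xs] [s' ys']].
      by exists [::] => Q; rewrite (linear_fun0 (act_linearl _ _)).
    exists (s ++ s') => Q; rewrite act_linearl coord_prod_cat -mulrA xs.
    by rewrite mulrCA ys' scaler0 addr0.
  - move=> x y [s xs] [s' ys']; exists (s ++ s') => Q.
    rewrite coord_prod_cat -mulrA act_lie ys' linear0 sub0r.
    by rewrite -[coord_prod m s]mulr1 xs linear0 oppr0.
  - move=> x [i [->|->]]; last exact: lowering_vector_annihilated.
    by exists [::] => Q; rewrite ev.
have [ss ssP] := fin_all_exists (fun i : 'I_(\dim {:g}) => Sfull (vbasis {:g})`_i).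
pose s := flatten [seq ss i | i <- enum 'I_(\dim {:g})].
have sv x Q : act x (coord_prod m s * Q) v = 0.
  rewrite (coord_vbasis (memvf x)) (linear_fun_sum (act_linearl _ _)) big1 // => i _.
  rewrite (linear_funZ (act_linearl _ _)).
  have -> : coord_prod m s = \prod_j coord_prod m (ss j).
    by rewrite /coord_prod big_flatten big_map big_enum.
  by rewrite (bigD1 i) //= -mulrA ssP scaler0.
(* The vectors killed by all [x (x) PQ] form a submodule. *)
exists s => x Q w; move: w x Q.
apply: (submodule_full genv).
- split=> [|b u w su sw] x Q; first by rewrite linear0.
  by rewrite linearP /= su sw scaler0 addr0.
- by [].
- by move=> y R w sw x Q; rewrite act_swap sw linear0 add0r -mulrA sw.
Qed.

Lemma lowering_finite_dimensional : finite_dimensional W.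
Proof.
have [s sP] := fin_all_exists exists_annihilating_coord_prod.
pose B := newton_basis s.
pose letters := [seq (i, b) | i <- enum 'I_r, b <- B].
pose next (l : seq W) := [seq act (f ib.1) ib.2 w | ib <- letters, w <- l].
(* The words of length less than [N] in the [f i (x) b], [b] in [B]; those of
   length [k] are listed by [iter k next [:: v]]. *)
pose l := flatten [seq iter k next [:: v] | k <- iota 0 N].
have lE w : w \in l <-> exists2 k, (k < N)%N & w \in iter k next [:: v].
  split=> [/flatten_mapP[k]|[k kN wk]].
    by rewrite mem_iota => kN wk; exists k.
  by apply/flatten_mapP; exists k; rewrite ?mem_iota.
have wordsE k w : w \in iter k next [:: v] -> exists s',
    [/\ size s' = k, forall q, q \in s' -> exists i, q.1 = f i & w = word s' v].
  elim: k w => [|k IH] w /=; first by rewrite inE => /eqP ->; exists [::].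
  move=> /allpairsP[[[i b] u] /= [_ /IH[s' [szs' s'f ->]] ->]].
  exists ((f i, b) :: s'); split=> //=; first by rewrite szs'.
  by move=> q; rewrite inE => /orP[/eqP ->|/s'f //]; exists i.
pose G w := w \in l.
have subG := lin_span_sub G.
have Gk k w : w \in iter k next [:: v] -> lin_span G w.
  move=> wk; have [kN|Nk] := ltnP k N.
    by apply: mem_lin_span; apply/lE; exists k.
  have [s' [szs' s'f ->]] := wordsE _ _ wk.
  by rewrite words0 ?szs' //; case: subG.
have Gfull : forall w, lin_span G w.
  apply: lowering_ind => // [i P||i P w Gw].
  - by eexists; exact: hv.
  - by apply: (Gk 0%N); rewrite /= inE.
  apply: (lin_span_preim (f := lact (tens (f i) P)) subG _ Gw) => u /lE[k _ uk].
  apply: (act_newton_basis (x := f i) (w := u) sP P subG) => _ [b bB ->].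
  apply: (Gk k.+1); apply/allpairsP; exists ((i, b), u); split=> //=.
  by apply/allpairsP; exists (i, b); split; rewrite ?mem_enum.
exists (size l), (fun i => l`_i) => w.
apply: (Gfull w (fun w => exists c : 'I_(size l) -> K, w = \sum_i c i *: l`_i)).
  split=> [|b _ _ [c ->] [c' ->]].
    by exists (fun=> 0); rewrite big1 // => i _; rewrite scale0r.
  exists (fun i => b * c i + c' i); rewrite scaler_sumr -big_split /=.
  by apply: eq_bigr => i _; rewrite scalerDl scalerA.
move=> u ul; have ul' : (index u l < size l)%N by rewrite index_mem.
exists (fun i => (i == Ordinal ul')%:R); rewrite (bigD1 (Ordinal ul')) //= eqxx scale1r.
by rewrite nth_index // big1 ?addr0 // => i /negPf ->; rewrite scale0r.
Qed.

End LoweringSpan.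

End CurrentAction.

Theorem theorem1 (R : realType) (g : finLieAlgType R[i]) (H : {vspace g})
  (alpha : 'I_(\dim H) -> weight H)
  (e : 'I_(\dim H) -> g) (h : 'I_(\dim H) -> subvs_of H) (f : 'I_(\dim H) -> g)
  (b_plus n_plus : {vspace g})
  (M : affineVariety R[i]) (lam : weight H) (Z : 'I_(\dim H) -> seq (point M))
  (W : lieModule (current g M)) (v : W) :
  semisimple g ->
  cartan_subalgebra H ->
  simple_roots alpha ->
  chevalley_generators alpha e h f ->
  is_positive_borel alpha b_plus ->
  is_nilradical b_plus n_plus ->
  dominant h lam ->
  is_multiset h lam Z ->
  is_local_weyl_module n_plus h Z v ->
  finite_dimensional W.
Proof.
move=> _ _ sr [rv ef a2 gen] bor nil _ _ [[intW genv nv hv] _].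
have [t t1] := exists_height_element (let: And3 _ fr _ := sr in fr).
have [N words0] := integrable_words_vanish t intW.
apply: (@lowering_finite_dimensional _ _ _ _ _ e (fun i => vsval (h i)) f
  (fun i j => alpha j (h i)) _ _ _ _ genv _ Z _ _ N).
- exact: ef.
- by move=> i j; rewrite (rv j).2 lfunE /= scaleNr.
- by move=> U subU UX; apply: gen => // i; split; apply: UX; exists i; [left|right].
- by move=> i P; apply: nv; exact: simple_root_vector_nilradical sr bor nil (rv i).1.
- exact: a2.
- exact: hv.
- move=> s w szs sf; apply: words0 => // q /sf[i ->].
  by rewrite (rv i).2 lfunE /= t1 scaleNr scale1r.
Qed.
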